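(* If $G$ is a non-elementary hyperbolic group, then $G_{bound}$ is trivial.
   Context: For a finitely generated group $G$, a finite generating set $S$ of $G$ and $g\in G$, the word-length $l_S(g)$ is the minimal integer $n\ge 0$ such that $g$ is a product of $n$ elements of $S\cup S^{-1}$. $G_{bound}$ denotes the set of all $g\in G$ for which there exists a constant $M>0$ such that $l_S(g)<M$ for every finite generating set $S$ of $G$; it is a subgroup of $G$. Hyperbolic means (Gromov) word-hyperbolic: $G$ is finitely generated and, for some $\delta\ge 0$, all geodesic triangles in its Cayley graph are $\delta$-thin. A hyperbolic group is elementary if it is finite or virtually cyclic, and non-elementary otherwise. *)

(* Defs.v *)
From HB Require Import structures.
From mathcomp Require Import all_boot.
From mathcomp Require Import boolp classical_sets functions cardinality.

Set Implicit Arguments.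
Unset Strict Implicit.
Unset Printing Implicit Defensive.

Local Open Scope classical_set_scope.

(* The value is 0 when P is empty; below, P is inhabited whenever it matters. *)
Definition least (P : set nat) : nat :=
  if pselect (exists n, `[< P n >]) is left ex then ex_minn ex else 0.

(* A graph is given by its adjacency relation [E] on vertices; the vertices
   p 0, ..., p n form a walk of length n, and values of p beyond n are
   irrelevant. *)
Definition walk (T : Type) (E : T -> T -> Prop) (x y : T) (n : nat)
    (p : nat -> T) : Prop :=
  [/\ p 0 = x, p n = y & forall i, i < n -> E (p i) (p i.+1)].

Definition graph_dist (T : Type) (E : T -> T -> Prop) (x y : T) : nat :=
  least [set n | exists p, walk E x y n p].

(* A is the set of vertices of a geodesic from x to y *)
Definition geodesic_side (T : Type) (E : T -> T -> Prop) (x y : T)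
    (A : set T) : Prop :=
  exists2 p : nat -> T, walk E x y (graph_dist E x y) p &
    A = [set p i | i in [set i | i <= graph_dist E x y]].

Definition nbhd_set (T : Type) (E : T -> T -> Prop) (delta : nat)
    (A : set T) : set T :=
  [set u | exists2 v, A v & graph_dist E u v <= delta].

(* Triangles of edge paths in the combinatorial graph: compared with its
   geometric realization, only the value of delta changes.  Distances between
   vertices are integers, so a natural number delta is no loss of generality.
   Thin is meant in the sense of Rips: each side is within delta of the union of
   the other two. *)
Definition thin_triangles (T : Type) (E : T -> T -> Prop) (delta : nat) : Prop :=
  forall (x y z : T) (A B C : set T),
    geodesic_side E x y A -> geodesic_side E y z B -> geodesic_side E z x C ->
    [/\ A `<=` nbhd_set E delta (B `|` C),
        B `<=` nbhd_set E delta (C `|` A)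
      & C `<=` nbhd_set E delta (A `|` B)].

Local Open Scope group_scope.

Definition sym_closure (G : groupType) (S : set G) : set G :=
  S `|` [set s^-1 | s in S].

Definition products (G : groupType) (S : set G) (n : nat) : set G :=
  [set g | exists w : seq G, [/\ size w = n,
     forall x, x \in w -> sym_closure S x & g = \prod_(x <- w) x]].

Definition generates (G : groupType) (S : set G) : Prop :=
  forall g : G, exists n, products S n g.

Definition word_length (G : groupType) (S : set G) (g : G) : nat :=
  least [set n | products S n g].

Definition G_bound (G : groupType) : set G :=
  [set g | exists2 M : nat, 0 < M &
     forall S : set G, finite_set S -> generates S -> word_length S g < M].
Arguments G_bound G : clear implicits.

Definition cayley_graph (G : groupType) (S : set G) (g h : G) : Prop :=
  exists2 s, sym_closure S s & h = g * s.

Definition hyperbolic (G : groupType) : Prop :=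
  exists S : set G, [/\ finite_set S, generates S &
    exists delta : nat, thin_triangles (cayley_graph S) delta].

Definition cyclic_subgroup (G : groupType) (c : G) : set G :=
  [set x | exists n : nat, x = c ^+ n \/ x = c ^- n].

Definition finite_index (G : groupType) (H : set G) : Prop :=
  finite_set [set [set g * h | h in H] | g in [set: G]].

Definition virtually_cyclic (G : groupType) : Prop :=
  exists c : G, finite_index (cyclic_subgroup c).

Definition elementary (G : groupType) : Prop :=
  finite_set [set: G] \/ virtually_cyclic G.

(* Main.v *)
Require Import Defs.
From mathcomp Require Import all_boot.
From mathcomp Require Import boolp classical_sets functions cardinality.
From mathcomp Require Import ssralg ssrint.
From mathcomp Require Import zify.

(** Fix a word length l on the hyperbolic group G.  Given g <> 1 and a bound M,
    a finite generating set is built in which g is longer than M.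

    The geometry is used through the four-point inequality
      d(x,y) + d(z,w) <= max (d(x,z) + d(y,w), d(x,w) + d(y,z)) + D,
    which turns each geometric step into linear arithmetic on distances.  It
    has a local-to-global consequence [len_prefix_grows]: if a product
    q1 q2 .. qn cancels little between consecutive factors compared with their
    lengths, then prepending a factor always increases the length.  In
    particular an s with l (s s) >= l s + 2 D + 1 has powers of strictly
    increasing length; such an s is called loxodromic below, and an infinite
    hyperbolic group contains one [exists_loxodromic].

    The elements g that conjugate some nontrivial power of s to another power
    of s form a subgroup, the commensurator of <s>.  It lies within bounded
    distance of <s>, so it is proper when G is not virtually cyclic
    [commensurator_proper].  If x is outside it, the axis of s and its translate
    by x share only a bounded segment, so s^m x s^n has length
    l (s^m) + l (s^n) up to a constant, uniformly in m and n
    [not_commensurates_bounded_overlap].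

    Now choose generators x_0, .., x_r of G outside the commensurator, which is
    possible as soon as it is proper, and set
      t = s^N,   n_i = 2 M (i + 1),   S = {t} U {t^(n_i) x_i t^(n_i)}.
    S generates G.  After free cancellation, a word of length at most M in S
    reads t^(m_0) y_1 t^(m_1) .. y_k t^(m_k) with each y_j some x_i or its
    inverse.  For k > 0 each m_j is nonzero: the n_i are positive and 2 M apart,
    so that at most M letters t cannot undo a padding or make up for two
    different ones, and if the paddings of x_i and of its inverse cancel, the
    word being reduced leaves a nontrivial power of t between them.  For N large
    the local-to-global principle makes such a product longer than g, unless the
    word is freely trivial [padded_word_length_ge].

    The x_i have to avoid the commensurator, not only 1: an x_i in a finite
    normal subgroup, for instance, commutes with a power of t, and padding does
    not separate it from its neighbours. *)

Set Implicit Arguments.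
Unset Strict Implicit.
Unset Printing Implicit Defensive.

Local Open Scope classical_set_scope.
Local Open Scope group_scope.

(** * Words and word length *)

Lemma leastP (P : set nat) : (exists n, P n) -> P (least P).
Proof.
move=> [n Pn]; rewrite /least; case: pselect => [ex|[]]; last first.
  by exists n; apply/asboolP.
by case: ex_minnP => m /asboolP.
Qed.

Lemma least_le (P : set nat) n : P n -> least P <= n.
Proof.
move=> Pn; rewrite /least; case: pselect => [ex|//].
by case: ex_minnP => m _; apply; apply/asboolP.
Qed.

Section Words.
Variable G : groupType.
Implicit Types (S : set G) (x y : G).

Lemma sym_closureV S x : sym_closure S x -> sym_closure S x^-1.
Proof. by case=> [Sx|[y Sy <-]]; [right; exists x | left; rewrite invgK]. Qed.

Lemma products0 S : products S 0 1.
Proof. by exists [::]; rewrite big_nil. Qed.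

Lemma products1 S x : sym_closure S x -> products S 1 x.
Proof.
move=> Sx; exists [:: x]; split=> //; last by rewrite big_seq1.
by move=> y; rewrite inE => /eqP ->.
Qed.

Lemma productsM S m n x y :
  products S m x -> products S n y -> products S (m + n) (x * y).
Proof.
move=> [v [<- vS ->]] [w [<- wS ->]]; exists (v ++ w).
rewrite size_cat big_cat; split=> // z; rewrite mem_cat => /orP[]; [exact: vS|exact: wS].
Qed.

Lemma productsV S n x : products S n x -> products S n x^-1.
Proof.
move=> [w [<- wS ->]]; elim: w wS => [|a w IHw] wS.
  by rewrite big_nil invg1; exact: products0.
rewrite big_cons invgM /= -addn1; apply: productsM.
  by apply: IHw => z zw; apply: wS; rewrite inE zw orbT.
by apply/products1/sym_closureV/wS; rewrite mem_head.
Qed.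

Lemma products_split S m n x :
  products S (m + n) x -> exists2 y, products S m y & products S n (y^-1 * x).
Proof.
move=> [w [sw wS ->]]; exists (\prod_(x <- take m w) x).
  exists (take m w); split=> //; last by move=> z /mem_take/wS.
  by rewrite size_takel // sw leq_addr.
exists (drop m w); split; first by rewrite size_drop sw addKn.
  by move=> z /mem_drop/wS.
by rewrite -{2}(cat_take_drop m w) big_cat /= mulKg.
Qed.

Lemma generates_subgroup S (P : G -> Prop) : generates S ->
    P 1 -> (forall x y, P x -> P y -> P (x * y)) -> (forall x, P x -> P x^-1) ->
    (forall x, S x -> P x) ->
  forall g, P g.
Proof.
move=> genS P1 PM PV PS g; have [n [w [_ wS ->]]] := genS g.
elim: w wS => [|x w IHw] wS; first by rewrite big_nil.
rewrite big_cons; apply: PM; last by apply: IHw => y yw; apply: wS; rewrite inE yw orbT.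
by have [/PS//|[y /PS Py <-]] := wS x (mem_head _ _); exact: PV.
Qed.

(** The premise says that S lies in the subgroup generated by T, with that
    subgroup given by its induction principle. *)
Lemma generates_trans S (T : set G) : generates S ->
    (forall P : G -> Prop, P 1 -> (forall x y, P x -> P y -> P (x * y)) ->
       (forall x, P x -> P x^-1) -> (forall x, T x -> P x) -> forall x, S x -> P x) ->
  generates T.
Proof.
move=> genS ST.
have T1 : exists n, products T n 1 by exists 0; exact: products0.
have TM x y : (exists n, products T n x) -> (exists n, products T n y) ->
    exists n, products T n (x * y).
  by move=> [m Pm] [n Pn]; exists (m + n); exact: productsM.
have TV x : (exists n, products T n x) -> exists n, products T n x^-1.
  by move=> [n Pn]; exists n; exact: productsV.
apply: (generates_subgroup genS) => //; apply: ST => // x Tx.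
by exists 1%N; apply: products1; left.
Qed.

Section Length.
Variables (S : set G) (genS : generates S).
Local Notation l := (word_length S).

Lemma word_lengthP x : products S (l x) x.
Proof. exact: leastP (genS x). Qed.

Lemma word_length_le n x : products S n x -> l x <= n.
Proof. exact: (least_le (P := [set n | products S n x])). Qed.

Lemma word_length1 : l 1 = 0.
Proof. by apply/eqP; rewrite -leqn0; apply/word_length_le/products0. Qed.

Lemma word_lengthV x : l x^-1 = l x.
Proof.
apply/eqP; rewrite eqn_leq -{3}(invgK x).
by rewrite !word_length_le //; apply/productsV/word_lengthP.
Qed.

Lemma word_lengthM x y : l (x * y) <= l x + l y.
Proof. by apply/word_length_le/productsM; exact: word_lengthP. Qed.

Lemma word_length_point x k : k <= l x ->
  exists2 y, l y = k & l (y^-1 * x) = l x - k.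
Proof.
move=> kx; have := word_lengthP x; rewrite -{1}(subnKC kx) => /products_split[y Py Px].
have := word_length_le Py; have := word_length_le Px.
have := word_lengthM y (y^-1 * x); rewrite mulVKg; exists y; lia.
Qed.

Lemma finite_products n : finite_set S -> finite_set [set x | products S n x].
Proof.
move=> finS; have finT : finite_set (sym_closure S).
  by rewrite finite_setU; split=> //; exact: finite_image.
elim: n => [|n IHn].
  apply: (sub_finite_set (B := [set 1])) => [x [w [/size0nil -> _ ->]]|] /=.
    by rewrite big_nil.
  exact: finite_set1.
apply: (sub_finite_set _ (finite_image2 (fun a x => a * x) finT IHn)) => x.
rewrite /= -{1}add1n => /products_split[a [w [sw wS ->]] Px].
case: w sw wS Px => [|b [|]] //= _ wS; rewrite big_seq1 => Px.
exists b; first by apply: wS; rewrite mem_head.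
by exists (b^-1 * x) => //; rewrite mulVKg.
Qed.

Lemma word_length_ball n : finite_set S -> finite_set [set x | l x <= n].
Proof.
move=> finS.
apply: (sub_finite_set (B := \bigcup_(k in [set k | k <= n]) [set x | products S k x])).
  by move=> x /= lx; exists (l x) => //; exact: word_lengthP.
apply: bigcup_finite => [|k _]; last exact: finite_products.
by apply: (sub_finite_set (B := `I_n.+1)) => //; exact: finite_II.
Qed.

Lemma walk_products x y n p : walk (cayley_graph S) x y n p ->
  forall i j, i <= j <= n -> products S (j - i) ((p i)^-1 * p j).
Proof.
move=> [_ _ pE] i j /andP[ij]; rewrite -{1 3}(subnKC ij).
elim: (j - i) => [|k IHk] jn; first by rewrite addn0 mulVg; exact: products0.
have [|s Ss] := pE (i + k); first by rewrite -addnS.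
rewrite addnS => ->; rewrite mulgA -addn1; apply: productsM; last exact: products1.
by apply: IHk; apply: ltnW; rewrite -addnS.
Qed.

Lemma products_walk n x g : products S n g ->
  exists p, walk (cayley_graph S) x (x * g) n p.
Proof.
elim: n g => [|n IHn] g.
  move=> [w [/size0nil -> _ ->]]; rewrite big_nil mulg1.
  by exists (fun=> x).
rewrite -{1}addn1 => /products_split[h /IHn[p [p0 pn pE]]].
move=> [w [sw wS def_w]].
exists (fun i => if i <= n then p i else x * g); split=> //; first by rewrite ltnn.
move=> i; rewrite ltnS /=; case: ltngtP => // [ltin _|-> _].
  exact: pE.
rewrite pn; exists (h^-1 * g); last by rewrite -mulgA mulVKg.
case: w sw wS def_w => [|b [|]] //= _ wS; rewrite big_seq1 => ->.
by apply: wS; rewrite mem_head.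
Qed.

Lemma graph_distE x y : graph_dist (cayley_graph S) x y = l (x^-1 * y).
Proof.
rewrite /graph_dist /word_length; congr least; apply/seteqP; split=> n /=.
  move=> [p wp]; have /= := walk_products wp (i := 0) (j := n).
  by case: wp => -> -> _; rewrite subn0; apply; rewrite leqnn.
by move=> /(products_walk x); rewrite mulVKg.
Qed.

End Length.
End Words.

(** * The four-point inequality *)

Definition dist (G : groupType) (l : G -> nat) (x y : G) : nat := l (x^-1 * y).

(** Everything that is needed of a word length on a hyperbolic group: beside the
    four-point inequality, balls are finite and [len_point] gives the points of
    a geodesic from 1 to x. *)
Record hyperbolic_length (G : groupType) (l : G -> nat) (D : nat) : Prop := {
  len1 : l 1 = 0;
  lenV : forall x, l x^-1 = l x;
  lenM : forall x y, l (x * y) <= l x + l y;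
  len_ball : forall n, finite_set [set x | l x <= n];
  len_point : forall x k, k <= l x ->
    exists2 y, l y = k & l (y^-1 * x) = l x - k;
  len_four_point : forall x y z w,
    dist l x y + dist l z w <=
      maxn (dist l x z + dist l y w) (dist l x w + dist l y z) + D }.

Section ThinTriangles.
Variables (G : groupType) (S : set G) (genS : generates S) (delta : nat).
Hypothesis thin : thin_triangles (cayley_graph S) delta.
Local Notation E := (cayley_graph S).
Local Notation l := (word_length S).
Local Notation d := (dist l).

Lemma wl_distC x y : d x y = d y x.
Proof. by rewrite /dist -word_lengthV // invgM invgK. Qed.

Lemma wl_dist_triangle x y z : d x z <= d x y + d y z.
Proof.
by rewrite /dist (_ : x^-1 * z = (x^-1 * y) * (y^-1 * z)) ?word_lengthM // -mulgA mulVKg.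
Qed.

Lemma geodesic_dist x y p i : walk E x y (d x y) p -> i <= d x y ->
  d x (p i) <= i /\ d (p i) y <= d x y - i.
Proof.
move=> wp iy; have := walk_products wp; case: wp => p0 pn _ wp.
split; first by have := wp 0 i; rewrite p0 subn0 /= => /(_ iy)/word_length_le.
by have := wp i (d x y); rewrite pn iy leqnn => /(_ isT)/word_length_le.
Qed.

Lemma exists_geodesic x y : exists p, walk E x y (d x y) p.
Proof.
have [p wp] := products_walk x (word_lengthP genS (x^-1 * y)).
by exists p; move: wp; rewrite mulVKg.
Qed.

(** A point near a vertex v of the side from x to z makes the path from x to z
    through it almost geodesic; a Rips thin triangle offers such a v on one of
    the two other sides. *)
Lemma geodesic_point_near_side x y z p i :
    walk E x y (d x y) p -> i <= d x y ->
  d x (p i) + d (p i) z <= d x z + 2 * delta \/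
  d y (p i) + d (p i) z <= d y z + 2 * delta.
Proof.
move=> wp iy; have [q wq] := exists_geodesic y z; have [r wr] := exists_geodesic z x.
have side a b c : walk E a b (d a b) c ->
    geodesic_side E a b [set c i | i in [set i | i <= d a b]].
  by move=> wc; exists c; rewrite graph_distE.
have [near _ _] := thin (side _ _ _ wp) (side _ _ _ wq) (side _ _ _ wr).
have [|_ [] [j /= jle <-]] := near (p i); first by exists i.
  rewrite graph_distE // -/(d _ _) => near_pj; right.
  have [] := geodesic_dist wq jle; have := wl_dist_triangle (p i) (q j) z.
  have := wl_dist_triangle y (q j) (p i); rewrite (wl_distC (q j)); lia.
rewrite graph_distE // -/(d _ _) => near_pj; left.
have [] := geodesic_dist wr jle; have := wl_dist_triangle (p i) (r j) z.
have := wl_dist_triangle x (r j) (p i).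
rewrite (wl_distC (r j) (p i)) (wl_distC x (r j)) (wl_distC (r j) z) (wl_distC x z); lia.
Qed.

(** Walking from x to y, the first point is near the side through x and the last
    one near the side through y, so somewhere consecutive points are near
    different sides. *)
Lemma geodesic_center x y z : exists p i, [/\ walk E x y (d x y) p, i <= d x y,
  d x (p i) + d (p i) z <= d x z + 2 * delta.+1 &
  d y (p i) + d (p i) z <= d y z + 2 * delta.+1].
Proof.
have [p wp] := exists_geodesic x y; exists p; case: (wp) => p0 pn pE.
apply: contrapT => no_center.
have near_x i : i <= d x y -> d x (p i) + d (p i) z <= d x z + 2 * delta.
  elim: i => [|i IHi] iy; first by rewrite p0 /dist mulVg word_length1; lia.
  case: (geodesic_point_near_side z wp iy) => // near_y; case: no_center; exists i.
  have adj : d (p i) (p i.+1) <= 1.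
    have := walk_products wp (i := i) (j := i.+1).
    by rewrite leqnSn iy subSnn => /(_ isT)/word_length_le.
  have := IHi (ltnW iy).
  have := wl_dist_triangle y (p i.+1) (p i); have := wl_dist_triangle (p i) (p i.+1) z.
  rewrite (wl_distC (p i.+1) (p i)) => ? ? ?; split=> //; lia.
case: no_center; exists (d x y); split=> //; have := near_x _ (leqnn _); first lia.
by rewrite pn {4}/dist mulVg word_length1; lia.
Qed.

(** Take p on the geodesic from x to y, near both sides that end at z.  It is also
    near one of the sides that end at w.  If that one starts at x, passing
    through p estimates d(x,w) + d(y,z) from below by
    d(x,p) + d(p,y) + d(p,z) + d(p,w); the other case is symmetric. *)
Lemma wl_four_point x y z w :
  d x y + d z w <= maxn (d x z + d y w) (d x w + d y z) + (4 * delta + 2).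
Proof.
have [p [i [wp iy near_xz near_yz]]] := geodesic_center x y z.
have := wl_dist_triangle x (p i) y; have := wl_dist_triangle z (p i) w.
have := geodesic_point_near_side w wp iy.
rewrite (wl_distC z (p i)) (wl_distC (p i) y); lia.
Qed.

End ThinTriangles.

Lemma hyperbolic_has_length (G : groupType) : hyperbolic G ->
  exists (S : set G) D, [/\ finite_set S, generates S &
    hyperbolic_length (word_length S) D].
Proof.
move=> [S [finS genS [delta thin]]]; exists S, (4 * delta + 2)%N; split=> //; split.
- exact: word_length1.
- exact: word_lengthV.
- exact: word_lengthM.
- by move=> n; apply: word_length_ball.
- exact: word_length_point.
- exact: wl_four_point.
Qed.

(** * Minimizers and large finite sets *)

Lemma exists_minimizer (T : Type) (f : T -> nat) (x0 : T) :
  exists x, forall y, f x <= f y.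
Proof.
have ex : exists n, `[< exists x, f x = n >] by exists (f x0); apply/asboolP; exists x0.
case: (ex_minnP ex) => _ /asboolP[x <-] min_x; exists x => y.
by apply: min_x; apply/asboolP; exists y.
Qed.

Lemma infinite_seq (T : choiceType) n : infinite_set [set: T] ->
  exists2 s : seq T, uniq s & size s = n.
Proof.
move=> infT; elim: n => [|n [s uniq_s <-]]; first by exists [::].
have [x] : exists x, x \notin s.
  apply: contrapT => all_s; apply: infT; apply/finite_seqP; exists s.
  by apply/seteqP; split=> // x _; apply/negPn/negP => xs; apply: all_s; exists x.
by move=> xs; exists (x :: s) => //=; rewrite xs.
Qed.

(** * Integer powers and the commensurator of a cyclic subgroup *)

Section IntegerPowers.
Variable G : groupType.
Implicit Types (s : G) (m n : int).

Definition zpow s m : G :=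
  match m with Posz n => s ^+ n | Negz n => s ^- n.+1 end.

Lemma zpowDnat s (k : nat) n : zpow s (Posz k + n)%R = s ^+ k * zpow s n.
Proof.
case: n => [n|n] /=; first by rewrite expgnDr.
have [le_kn|lt_nk] := leqP k n.
  have -> : (Posz k + Negz n)%R = Negz (n - k) by lia.
  rewrite /= -{2}(subnKC le_kn) -addnS expgnDr.
  have -> : s ^+ k * s ^+ (n - k).+1 = s ^+ (n - k).+1 * s ^+ k.
    by rewrite -!expgnDr addnC.
  by rewrite invgM mulVKg.
have -> : (Posz k + Negz n)%R = (k - n.+1)%N by lia.
by rewrite /= expgnFr.
Qed.

Lemma zpowN s m : zpow s (- m)%R = (zpow s m)^-1.
Proof.
case: m => [[|n]|n]; first by rewrite GRing.oppr0 /= expg0 invg1.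
  by rewrite (_ : (- Posz n.+1)%R = Negz n) //; lia.
by rewrite (_ : (- Negz n)%R = Posz n.+1) /= ?invgK //; lia.
Qed.

Lemma zpowD s m n : zpow s (m + n)%R = zpow s m * zpow s n.
Proof.
case: m => [m|m]; first exact: zpowDnat.
apply: (mulgI (s ^+ m.+1)); rewrite /= mulVKg -zpowDnat; congr zpow; lia.
Qed.

Lemma zpowM s m n : zpow s (m * n)%R = zpow (zpow s m) n.
Proof.
have nat_case (k : nat) : zpow s (m * Posz k)%R = zpow s m ^+ k.
  elim: k => [|k IHk]; first by rewrite GRing.mulr0 expg0.
  rewrite expgS -IHk -zpowD; congr zpow; lia.
case: n => n; first exact: nat_case.
by rewrite NegzE GRing.mulrN !zpowN nat_case.
Qed.

Lemma zpow_expg s (e : bool) (k : nat) :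
  (if e then s else s^-1) ^+ k = zpow s (if e then Posz k else - Posz k)%R.
Proof. by case: e => //; rewrite zpowN expVgn. Qed.

(** For s of infinite order these g form the commensurator of <s>. *)
Definition commensurates s g : Prop :=
  exists p q : int, [/\ p <> 0%R, q <> 0%R & g * zpow s p = zpow s q * g].

Lemma commensurates1 s : commensurates s 1.
Proof. by exists 1%R, 1%R; rewrite mulg1 mul1g. Qed.

Lemma commensuratesV s g : commensurates s g -> commensurates s g^-1.
Proof.
move=> [p [q [p0 q0 gpq]]]; exists q, p; split=> //.
by apply: (mulgI g); rewrite mulVKg mulgA gpq mulgK.
Qed.

Lemma commensuratesM s g h :
  commensurates s g -> commensurates s h -> commensurates s (g * h).
Proof.
move=> [p [q [p0 q0 gpq]]] [p' [q' [p0' q0' hpq]]].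
have power x a b (c : int) : x * zpow s a = zpow s b * x ->
    x * zpow s (a * c)%R = zpow s (b * c)%R * x.
  rewrite !zpowM => xab; have {xab} -> : zpow s b = zpow s a ^ x^-1.
    by rewrite /conjg invgK mulgA xab mulgK.
  have nat_case (k : nat) : x * zpow s a ^+ k = (zpow s a ^ x^-1) ^+ k * x.
    by rewrite -conjXg conjgE invgK !mulgA mulgVK.
  case: c => c; rewrite /= ?nat_case //.
  by rewrite -conjXg -conjVg conjgE invgK !mulgA mulgVK.
exists (p' * p)%R, (q * q')%R; split; try lia.
rewrite -mulgA (power _ _ _ _ hpq) mulgA GRing.mulrC (power _ _ _ _ gpq).
by rewrite mulgA.
Qed.

End IntegerPowers.

(** * Local-to-global and loxodromic elements *)

Section Hyperbolic.
Variables (G : groupType) (l : G -> nat) (D : nat).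
Hypothesis hypl : hyperbolic_length l D.
Implicit Types x y z w u v s g h : G.
Local Notation d := (dist l).

Let l1 := len1 hypl.
Let lV := lenV hypl.
Let lM := lenM hypl.
Let four_point := len_four_point hypl.

Lemma distC x y : d x y = d y x.
Proof. by rewrite /dist -lV invgM invgK. Qed.

Lemma dist1 x : d 1 x = l x.
Proof. by rewrite /dist invg1 mul1g. Qed.

Lemma distMl x y z : d (x * y) (x * z) = d y z.
Proof. by rewrite /dist invgM -mulgA mulKg. Qed.

Lemma distKl x y : d x (x * y) = l y.
Proof. by rewrite /dist mulKg. Qed.

Lemma dist_triangle x y z : d x z <= d x y + d y z.
Proof.
by rewrite /dist (_ : x^-1 * z = (x^-1 * y) * (y^-1 * z)) ?lM // -mulgA mulVKg.
Qed.

(** The four-point inequality for 1, q1, q1 q2, q1 q2 r: the pairing of 1 with q1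
    and of q1 q2 with q1 q2 r cannot be the larger one, and the other one gives
    the claim.  The conclusion has the form of the last premise, so that the lemma
    can be iterated along a product with many factors. *)
Lemma len_prefix_grows q1 q2 r :
    l q1 + D.*2.+1 <= l (q1 * q2) -> l q2 + D.*2.+1 <= l (q1 * q2) ->
    l r + D.+1 <= l (q2 * r) ->
  l (q2 * r) + D.+1 <= l (q1 * (q2 * r)).
Proof.
move=> le1 le2 le_r.
have := four_point 1 (q1 * q2) q1 (q1 * q2 * r).
have -> : q1 * q2 * r = q1 * (q2 * r) by rewrite mulgA.
have -> : d (q1 * q2) (q1 * (q2 * r)) = l r by rewrite mulgA distKl.
rewrite !dist1 (distC _ q1) !distKl; lia.
Qed.

(** The excess makes [len_prefix_grows] applicable with all factors equal to s. *)
Definition loxodromic s := l s + D.*2.+1 <= l (s * s).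

Section Powers.
Variables (s : G) (lox : loxodromic s).

Lemma lox_len_step n : l (s ^+ n) + D.+1 <= l (s ^+ n.+1).
Proof.
elim: n => [|n IHn].
  by rewrite expg0 expg1 l1; have := lM s s; move: lox; rewrite /loxodromic; lia.
by rewrite !expgS in IHn *; exact: len_prefix_grows.
Qed.

Lemma lox_len_ltn m n : m < n -> l (s ^+ m) < l (s ^+ n).
Proof.
elim: n => // n IHn; rewrite ltnS leq_eqVlt => /predU1P[->|/IHn].
  have := lox_len_step n. lia.
have := lox_len_step n. lia.
Qed.

Lemma lox_len_leq m n : m <= n -> l (s ^+ m) <= l (s ^+ n).
Proof. by rewrite leq_eqVlt => /predU1P[->|/lox_len_ltn/ltnW]. Qed.

Lemma lox_len_ge n : n <= l (s ^+ n).
Proof.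
elim: n => // n IHn; apply: leq_ltn_trans IHn _; exact: lox_len_ltn.
Qed.

(** Powers of s stay near a geodesic: s^m is almost between 1 and s^(m+n). *)
Lemma lox_len_add m n : l (s ^+ m) + l (s ^+ n) <= l (s ^+ (m + n)) + (l s + D).
Proof.
case: m => [|m]; first by rewrite expg0 l1 !add0n leq_addr.
have := four_point 1 (s ^+ m.+1) (s ^+ m) (s ^+ (m.+1 + n)).
have -> : d (s ^+ m) (s ^+ (m.+1 + n)) = l (s ^+ n.+1).
  by rewrite addSnnS expgnDr distKl.
have -> : d (s ^+ m.+1) (s ^+ (m.+1 + n)) = l (s ^+ n) by rewrite expgnDr distKl.
have -> : d (s ^+ m.+1) (s ^+ m) = l s by rewrite distC expgSr distKl.
have := lox_len_step m; have := lox_len_step n; rewrite !dist1; lia.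
Qed.

End Powers.

Lemma loxodromicV s : loxodromic s -> loxodromic s^-1.
Proof. by rewrite /loxodromic -invgM !lV. Qed.

Lemma dist_inv_self x : d x x^-1 = l (x * x).
Proof. by rewrite /dist -invgM lV. Qed.

Lemma distVl x y : d x^-1 y = l (x * y).
Proof. by rewrite /dist invgK. Qed.

(** Without loxodromic elements every element almost fixes the midpoint of its
    displacement, so a and its inverse leave 1 in almost the same direction.  Let
    k be the point at distance 2 D + 1 on a geodesic from 1 to a.  Moving the base
    point from 1 to k decreases the displacement of a.  If it does not decrease
    that of b, then b leaves 1 in another direction than a; then ab and ba have
    almost no cancellation, and ab is loxodromic if a is long. *)
Lemma no_loxodromic_displacement a b k :
    (forall s, ~ loxodromic s) -> l b <= l a ->
    l k = D.*2.+1 -> l (k^-1 * a) = l a - D.*2.+1 -> l a <= l (b ^ k) ->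
  l a <= 12 * D + 8.
Proof.
move=> noLox le_ba lk lka lbk; rewrite leqNgt; apply/negP => a_long.
have short s : l (s * s) <= l s + D.*2.
  by have := noLox s; rewrite /loxodromic; lia.
have le_b : l a <= l b + (D.*2.+1).*2.
  have : l (b ^ k) <= l k + l (b * k) by rewrite -(lV k); exact: lM.
  have := lM b k; lia.
have dkbk : d k (b * k) = l (b ^ k) by [].
have dbkb : d (b * k) b = l k by rewrite distC distKl.
have dbk1 : d (b * k) 1 = d k b^-1 by rewrite distC dist1 distC distVl.
have opposite : l a + l b <= d k b + d k b^-1 + D.
  have := four_point k (b * k) 1 b; rewrite dkbk dbkb dbk1 (distC k 1) !dist1; lia.
have dkb : l b <= d k b + D.
  have := four_point 1 b k b^-1; have := short b; have := dist_triangle k 1 b.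
  rewrite dist_inv_self (distC k 1) (distC b k) !dist1 lV; lia.
have dab : l a + l b <= d a b + (D.*2).*2.+1.
  have := four_point 1 a k b; have -> : d a k = l (k^-1 * a) by rewrite distC.
  rewrite !dist1; lia.
have lab : l a + l b <= l (a * b) + 5 * D + 1.
  have := four_point a b 1 a^-1; have := short a.
  have -> : d b a^-1 = l (a * b) by rewrite distC distVl.
  rewrite dist_inv_self !(distC _ 1) !dist1 lV; lia.
have lba : l a + l b <= l (b * a) + 5 * D + 1.
  have := four_point b a 1 b^-1; have := short b.
  have -> : d a b^-1 = l (b * a) by rewrite distC distVl.
  rewrite dist_inv_self (distC b a) !(distC _ 1) !dist1 lV; lia.
have step1 : l (a * b) + D.+1 <= l (b * (a * b)).
  by apply: len_prefix_grows; lia.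
have step2 : l (b * (a * b)) + D.+1 <= l (a * (b * (a * b))).
  by apply: len_prefix_grows; lia.
have := short (a * b).
have -> : a * b * (a * b) = a * (b * (a * b)) by rewrite -mulgA.
lia.
Qed.

(** A coarse Serre lemma: if no element is loxodromic, any finite set almost fixes
    a common point, namely one that minimizes the largest displacement.  The
    bound is uniform in Y. *)
Lemma no_loxodromic_bounded_orbit (Y : seq G) : (forall s, ~ loxodromic s) ->
  exists h, forall y, y \in Y -> l (y ^ h) <= 12 * D + 8.
Proof.
move=> noLox; pose m h := \max_(y <- Y) l (y ^ h).
have [h min_h] := exists_minimizer m 1.
have le_m z h' : z \in Y -> l (z ^ h') <= m h'.
  by move=> zY; exact: (@leq_bigmax_seq _ Y xpredT (fun z => l (z ^ h'))).
exists h => y yY; apply: leq_trans (le_m _ _ yY) _.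
rewrite leqNgt; apply/negP => m_big.
have attained h' : exists2 z, z \in Y & m h <= l (z ^ h').
  apply: contrapT => none; have := min_h h'; rewrite leqNgt => /negP; apply.
  apply: (leq_ltn_trans (n := (m h).-1)); last lia.
  apply/bigmax_leqP_seq => z zY _; rewrite -ltnS prednK; last lia.
  by rewrite ltnNge; apply/negP => le_z; apply: none; exists z.
have [a aY le_a] := attained h.
have [|k lk lka] := len_point hypl (x := a ^ h) (k := D.*2.+1); first lia.
have [b bY le_b] := attained (h * k).
suff : l (a ^ h) <= 12 * D + 8 by lia.
apply: (no_loxodromic_displacement (b := b ^ h) (k := k)) => //.
  exact: leq_trans (le_m _ _ bY) le_a.
by rewrite -conjgM; apply: leq_trans le_b; exact: le_m.
Qed.

Lemma ball_seq n : exists L : seq G, forall x, l x <= n -> x \in L.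
Proof.
have /finite_seqP[L defL] := len_ball hypl n; exists L => x lx.
by have : [set` L] x by rewrite -defL.
Qed.

(** Otherwise finite sets of any cardinality could be conjugated into a ball of
    fixed radius. *)
Lemma exists_loxodromic : infinite_set [set: G] -> exists s, loxodromic s.
Proof.
move=> infG; apply: contrapT => noLox.
have {}noLox s : ~ loxodromic s by move=> lox; apply: noLox; exists s.
have [L ballL] := ball_seq (12 * D + 8).
have [Y uniqY sizeY] := infinite_seq (size L).+1 infG.
have [h shortY] := no_loxodromic_bounded_orbit Y noLox.
have : size [seq y ^ h | y <- Y] <= size L.
  apply: uniq_leq_size; first by rewrite map_inj_uniq //; exact: conjg_inj.
  by move=> _ /mapP[y /shortY short_y ->]; exact: ballL.
by rewrite size_map sizeY ltnn.
Qed.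

(** * Bounded overlap of axes *)

Section Overlap.
Variables (u v b : G) (loxu : loxodromic u) (loxv : loxodromic v).
Let c := (l b + l u + l v + D)%N.

(** Two orbits that cancel for a long time fellow-travel: geodesics from 1 to u^m
    and from 1 to b v^m' stay together past the distance of u^i, and the points of
    either orbit are near its geodesic, so points of both orbits at about the same
    distance from 1 are near each other.  The bound does not depend on n. *)
Lemma overlap_shadow n m m' i :
    d (u ^+ m) (b * v ^+ m') + (2 * l (u ^+ n) + 6 * c) <
      l (u ^+ m) + l (v ^+ m') ->
  i <= n -> exists j, d (u ^+ i) (b * v ^+ j) <= 6 * c.
Proof.
move=> long le_in; set X := u ^+ m in long *; set Y := b * v ^+ m' in long *.
have lY : l Y <= l b + l (v ^+ m') := lM _ _.
have lY' : l (v ^+ m') <= l b + l Y.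
  by rewrite -(mulKg b (v ^+ m')); apply: leq_trans (lM _ _) _; rewrite lV.
have := dist_triangle 1 X Y; have := dist_triangle 1 Y X.
rewrite (distC Y) !dist1 => tX tY.
have lt_nm : n < m.
  by rewrite ltnNge; apply/negP => /(lox_len_leq loxu); rewrite -/X; lia.
have le_ui : l (u ^+ i) <= l (u ^+ n) := lox_len_leq loxu le_in.
have Yfar : l (u ^+ i) <= l Y by lia.
(* the first point of the second orbit that is at least as far from 1 as u ^+ i *)
have [j [le_jm' le_V V_le]] : exists j, [/\ j <= m',
    l (u ^+ i) <= l (b * v ^+ j) & l (b * v ^+ j) <= l (u ^+ i) + l b + l v].
  have exj : exists j, l (u ^+ i) <= l (b * v ^+ j) by exists m'.
  case: (ex_minnP exj) => j le_j min_j; exists j; split=> //; first exact: min_j.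
  case: j le_j min_j => [|j] _ min_j; first by rewrite expg0 mulg1; lia.
  have : l (b * v ^+ j) < l (u ^+ i).
    by rewrite ltnNge; apply/negP => /min_j; rewrite ltnn.
  have : l (b * v ^+ j.+1) <= l (b * v ^+ j) + l v by rewrite expgSr mulgA; exact: lM.
  lia.
exists j; set U := u ^+ i in le_ui Yfar le_V V_le *; set V := b * v ^+ j in le_V V_le *.
have dUX : l U + d U X <= l X + (l u + D).
  have le_im : i <= m by lia.
  have := lox_len_add loxu i (m - i); rewrite subnKC //.
  suff -> : d U X = l (u ^+ (m - i)) by [].
  by rewrite /U /X -{1}(subnKC le_im) expgnDr distKl.
have dVY : l V + d V Y <= l Y + (l v + D + 2 * l b).
  have := lox_len_add loxv j (m' - j); rewrite subnKC //.
  have -> : d V Y = l (v ^+ (m' - j)).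
    by rewrite /V /Y -{1}(subnKC le_jm') expgnDr mulgA distKl.
  have : l V <= l b + l (v ^+ j) := lM _ _.
  by lia.
have := four_point X V 1 Y; have := four_point U V 1 X.
rewrite !(distC _ 1) !dist1 (distC V X).
by rewrite /c in long *; lia.
Qed.

(** If the overlap is so long that more points u^i have a neighbour b v^j than
    there are elements in a ball, then two of the differences coincide. *)
Lemma bounded_overlap_or_coincidence :
  (exists R, forall m n,
     l (u ^+ m) + l (v ^+ n) <= d (u ^+ m) (b * v ^+ n) + R) \/
  exists i i' j j', i < i' /\
    (u ^+ i)^-1 * (b * v ^+ j) = (u ^+ i')^-1 * (b * v ^+ j').
Proof.
have [L ballL] := ball_seq (6 * c); set n := size L.
have [[m [m' long]]|bounded] := pselect (exists m m',
    d (u ^+ m) (b * v ^+ m') + (2 * l (u ^+ n) + 6 * c) < l (u ^+ m) + l (v ^+ m')).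
  right; have /choice[j close_j] i : exists j, i <= n -> d (u ^+ i) (b * v ^+ j) <= 6 * c.
    have [le_in|] := boolP (i <= n); last by exists 0.
    by have [j] := overlap_shadow long le_in; exists j.
  pose f i := (u ^+ i)^-1 * (b * v ^+ j i).
  have : ~~ uniq [seq f i | i <- iota 0 n.+1].
    apply/negP => uniq_f; suff : size [seq f i | i <- iota 0 n.+1] <= size L.
      by rewrite size_map size_iota ltnn.
    apply: uniq_leq_size uniq_f _.
    move=> x /mapP[i]; rewrite mem_iota add0n ltnS => /= le_in ->.
    by apply: ballL; exact: close_j i le_in.
  move/(uniqPn 1) => [i [i' [lt_ii']]]; rewrite size_map size_iota => lt_i'n.
  rewrite !(nth_map 0) ?size_iota //; last exact: ltn_trans lt_i'n.
  rewrite !nth_iota //; last exact: ltn_trans lt_i'n.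
  by rewrite !add0n => eq_f; exists i, i', (j i), (j i').
left; exists (2 * l (u ^+ n) + 6 * c)%N => m m'.
by rewrite leqNgt; apply/negP => long; apply: bounded; exists m, m'.
Qed.

End Overlap.

(** * The commensurator of a loxodromic element *)

Section Commensurator.
Variables (s : G) (lox : loxodromic s).

Lemma len_zpow m : l (zpow s m) = l (s ^+ `|m|%N).
Proof. by case: m => m //=; rewrite lV. Qed.

Lemma zpow_inj : injective (zpow s).
Proof.
move=> m n eq_mn; have := lox_len_ge lox `|m - n|%N.
rewrite -len_zpow zpowD zpowN -eq_mn mulgV l1; lia.
Qed.

Lemma coincidence_commensurates g a b a' b' : a <> a' ->
    zpow s a * g * zpow s b = zpow s a' * g * zpow s b' ->
  commensurates s g.
Proof.
move=> neq_a coin; exists (b - b')%R, (a' - a)%R; split.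
- move=> /eqP; rewrite GRing.subr_eq0 => /eqP eq_b; apply: neq_a; apply: zpow_inj.
  by apply: (mulIg g); apply: (mulIg (zpow s b')); rewrite -coin eq_b.
- by move=> /eqP; rewrite GRing.subr_eq0 => /eqP/esym.
- rewrite zpowD zpowN GRing.addrC zpowD zpowN -!mulgA; apply: (mulgI (zpow s a)).
  by apply: (mulIg (zpow s b')); rewrite !mulgA mulgVK mulgV mul1g.
Qed.

Lemma not_commensurates_bounded_overlap g : ~ commensurates s g ->
  exists R, forall m n,
    l (zpow s m) + l (zpow s n) <= l (zpow s m * g * zpow s n) + R.
Proof.
move=> ncomm; pose sg (e : bool) := if e then s else s^-1.
have lox_sg e : loxodromic (sg e) by case: e => //; exact: loxodromicV.
have bounded e e' : exists R, forall m n,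
    l (sg e ^+ m) + l (sg e' ^+ n) <= d (sg e ^+ m) (g * sg e' ^+ n) + R.
  have [//|] := bounded_overlap_or_coincidence g (lox_sg e) (lox_sg e').
  move=> [i [i' [j [j' [lt_ii']]]]]; rewrite !zpow_expg -!zpowN !mulgA => coin.
  case: ncomm; apply: (coincidence_commensurates _ coin).
  by case: (e) lt_ii'; lia.
have [R11 P11] := bounded true true; have [R10 P10] := bounded true false.
have [R01 P01] := bounded false true; have [R00 P00] := bounded false false.
exists (R11 + R10 + R01 + R00) => m n.
have sign_abs a : exists e, zpow s a = sg e ^+ `|a|%N.
  by case: a => k; [exists true | exists false; rewrite /sg expVgn].
have [e def_m] := sign_abs (- m)%R; have [e' def_n] := sign_abs n.
have -> : l (zpow s m) = l (sg e ^+ `|(- m)%R|%N) by rewrite -def_m zpowN lV.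
have -> : l (zpow s m * g * zpow s n) = d (zpow s (- m)%R) (g * zpow s n).
  by rewrite zpowN distVl mulgA.
rewrite def_m def_n; set i := `|_|%N; set j := `|_|%N.
have := P11 i j; have := P10 i j; have := P01 i j; have := P00 i j.
by case: (e) (e') => [] []; lia.
Qed.

(** The points g v^(a n) = s^(b n) g of the translated axis are within l g of the
    axis of s.  For k large this error disappears near g: both ends are far from g,
    so g is almost between s^(-b k) and s^(b k), up to a constant free of g, and
    some power of s is near g. *)
Lemma commensurated_orbit_near_axis g v (a b : nat) :
    loxodromic v -> 0 < a -> 0 < b ->
    g * v ^+ a = s ^+ b * g ->
  exists i : int, d (zpow s i) g <= 10 * (l s + l v + D).
Proof.
move=> loxv a_gt0 b_gt0 gvs.
pose k := 10 * (l g + l s + l v + D) + 1.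
have gvsX n : g * v ^+ (a * n) = s ^+ (b * n) * g.
  have /(congr1 (fun x => x ^+ n)) : v ^+ a = (s ^+ b) ^ g.
    by rewrite conjgE -gvs mulKg.
  by rewrite -conjXg -!expgnA conjgE => ->; rewrite mulVKg.
set V := v ^+ (a * k); set U := s ^+ (b * k).
have gVU : g * V = U * g by exact: gvsX.
have gVU' : g * V^-1 = U^-1 * g.
  by apply: (mulgI U); rewrite mulVKg mulgA -gVU mulgK.
have V_long : k <= l V.
  by apply: leq_trans (lox_len_ge loxv _); rewrite leq_pmull.
have VV : 2 * l V <= l (V * V) + (l v + D).
  have -> : V * V = v ^+ (a * k + a * k) by rewrite expgnDr.
  by have := lox_len_add loxv (a * k) (a * k); rewrite -/V; lia.
have dAA' : d U^-1 (g * V^-1) = l g by rewrite gVU' distKl.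
have dBB' : d U (g * V) = l g by rewrite gVU distKl.
have dA'g : d (g * V^-1) g = l V by rewrite distC distKl lV.
have dgB' : d g (g * V) = l V by rewrite distKl.
have dA'B' : d (g * V^-1) (g * V) = l (V * V) by rewrite distMl distVl.
have dAB : d U^-1 U = l (U * U) by rewrite distVl.
have tA := dist_triangle U^-1 (g * V^-1) g.
have tA' := dist_triangle (g * V^-1) U^-1 g.
have tB := dist_triangle g (g * V) U.
have tAB := dist_triangle (g * V^-1) U^-1 (g * V).
have tAB' := dist_triangle U^-1 U (g * V).
(* g is between g V^-1 and g V, which are l g away from U^-1 and U, while l V is
   much larger than l g *)
have between : d U^-1 g + d g U <= d U^-1 U + (l v + 3 * D).
  have := four_point (g * V^-1) (g * V) U^-1 g.
  have := four_point U^-1 (g * V) g U.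
  rewrite (distC (g * V^-1) U^-1) (distC (g * V) g).
  rewrite (distC (g * V) U^-1) (distC (g * V) U).
  rewrite ?dAA' ?dBB' ?dA'g ?dgB' ?dA'B'.
  rewrite /k in V_long *; lia.
have lUU : l (U * U) = l (s ^+ (b * k + b * k)) by rewrite expgnDr.
have exj : exists j, d U^-1 g <= l (s ^+ j).
  by exists (d U^-1 g); exact: lox_len_ge.
case: (ex_minnP exj) => j le_j min_j.
have j_le : j <= b * k + b * k.
  apply: min_j; rewrite -lUU -dAB.
  by move: tAB' tAB; rewrite (distC _ U^-1) dAA' dA'B' dBB' /k in V_long *; lia.
have {min_j} j_ge : l (s ^+ j) <= d U^-1 g + l s.
  case: j le_j min_j {j_le} => [|j] _ min_j; first by rewrite expg0 l1.
  have : l (s ^+ j) < d U^-1 g.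
    by rewrite ltnNge; apply/negP => /min_j; rewrite ltnn.
  have : l (s ^+ j.+1) <= l (s ^+ j) + l s by rewrite expgSr; exact: lM.
  lia.
pose z := U^-1 * s ^+ j.
have dAz : d U^-1 z = l (s ^+ j) by rewrite distKl.
have dzB : d z U = l (s ^+ (b * k + b * k - j)).
  suff -> : U = z * s ^+ (b * k + b * k - j) by rewrite distKl.
  by rewrite /z -mulgA -expgnDr subnKC // expgnDr mulKg.
have := lox_len_add lox j (b * k + b * k - j); 
rewrite subnKC // -lUU -dAB -dAz -dzB => zU.
exists (Posz j - Posz (b * k))%R.
have -> : zpow s (Posz j - Posz (b * k))%R = z.
  by rewrite GRing.addrC zpowD zpowN.
by have := four_point z g U^-1 U; rewrite (distC z U^-1) (distC g U^-1); lia.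
Qed.

Lemma commensurator_near : exists C, forall g, commensurates s g ->
  exists i : int, d (zpow s i) g <= C.
Proof.
exists (10 * (l s + l s + D))%N => g [p [q [p0 q0 gpq]]].
have from_pos (a : int) (b : nat) : a <> 0%R -> g * zpow s a = s ^+ b.+1 * g ->
    exists i : int, d (zpow s i) g <= 10 * (l s + l s + D).
  case: a => [a|a] a0 gab; last rewrite -{2}(lV s).
    by apply: (commensurated_orbit_near_axis (a := a) (b := b.+1)) => //; lia.
  apply: (commensurated_orbit_near_axis (a := a.+1) (b := b.+1)) => //.
    exact: loxodromicV.
  by rewrite expVgn.
case: q q0 gpq => [[//|b]|b] _ gpq; first exact: from_pos p0 gpq.
apply: (from_pos (- p)%R b); first lia.
by rewrite zpowN; apply: (mulgI (s ^- b.+1)); rewrite mulKg mulgA -gpq mulgK.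
Qed.

Lemma cyclic_subgroupE : cyclic_subgroup s = range (zpow s).
Proof.
apply/seteqP; split=> x /=.
  move=> [n [->|->]]; first by exists (Posz n).
  by exists (- Posz n)%R => //; rewrite zpowN.
by move=> [[n|n] _ <-]; [exists n; left | exists n.+1; right].
Qed.

(** If all of G commensurates <s>, every element is a power of s times an element
    of a fixed ball, so that <s> has finite index. *)
Lemma commensurator_proper :
  ~ virtually_cyclic G -> exists g, ~ commensurates s g.
Proof.
move=> nvc; apply: contrapT => all_comm; apply: nvc; exists s.
have [C near] := commensurator_near.
pose coset x := [set x^-1 * h | h in cyclic_subgroup s].
apply: sub_finite_set (finite_image coset (len_ball hypl C)) => _ [g _ <-].
have [|i close_g] := near g^-1.
  by apply: contrapT => ng; apply: all_comm; exists g^-1.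
exists ((zpow s i)^-1 * g^-1) => //; rewrite /coset invgM !invgK cyclic_subgroupE.
apply/seteqP; split=> x [_ [n _ <-] <-].
  by exists (zpow s (i + n)%R); [exists (i + n)%R | rewrite zpowD mulgA].
by exists (zpow s (- i + n)%R); [exists (- i + n)%R | rewrite zpowD zpowN -mulgA mulVKg].
Qed.

End Commensurator.

End Hyperbolic.

(** * Generating sets with padding *)

Section PaddedGenerators.
Variables (G : groupType) (t : G) (X : seq G) (M : nat).
Implicit Types (a b : G * bool) (c m : int) (g v : G).

(** A letter (x, true) stands for the padded generator of x, and (x, false) for its
    inverse.  The padding of x determines the position of x in X, and two
    different paddings differ by at least 2 M. *)
Definition padding a : int :=
  let k := Posz (2 * M * (index a.1 X).+1) in if a.2 then k else (- k)%R.

Definition core a : G := if a.2 then a.1 else a.1^-1.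

Definition block a : G := zpow t (padding a) * core a * zpow t (padding a).

Definition flip a := (a.1, ~~ a.2).

Definition padded_generators : set G :=
  t |` [set block (x, true) | x in [set` X]].

(** [reduced k h v]: v is the value of a word in the blocks and t that is either
    empty or starts with a block; h is this first block.  Consecutive blocks are
    separated by a power of t with exponent at most k in absolute value, and
    inverse blocks by a nontrivial one. *)
Inductive reduced (k : nat) : option (G * bool) -> G -> Prop :=
| ReducedNil : reduced k None 1
| ReducedCons a c h v : a.1 \in X -> `|c|%N <= k -> reduced k h v ->
    (h = Some (flip a) -> c <> 0%R) ->
    reduced k (Some a) (block a * zpow t c * v).

Lemma reduced_leq j k h v : j <= k -> reduced j h v -> reduced k h v.
Proof.
move=> le_jk; elim=> [|a c h' v' aX cj _ IH hc]; first exact: ReducedNil.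
exact: ReducedCons aX (leq_trans cj le_jk) IH hc.
Qed.

Lemma block_flip a : block (flip a) = (block a)^-1.
Proof.
rewrite /block /flip /core /padding; case: a => x [] /=;
  by rewrite ?zpowN !invgM ?invgK mulgA.
Qed.

Lemma padded_generatorsP g : sym_closure padded_generators g ->
  (exists2 e : int, `|e|%N = 1%N & g = zpow t e) \/
  (exists2 a, a.1 \in X & g = block a).
Proof.
have gen h : padded_generators h ->
    h = zpow t 1%R \/ exists2 a, a.1 \in X & h = block a.
  by case=> [->|[x xX <-]]; [left; rewrite /= expg1 | right; exists (x, true)].
case=> [/gen[->|]|[h /gen[->|[a aX ->]] <-]].
- by left; exists 1%R.
- by right.
- by left; exists (- 1)%R => //; rewrite zpowN.
- by right; exists (flip a) => //; rewrite block_flip.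
Qed.

Lemma products_reduced k g : products padded_generators k g ->
  exists h c v, [/\ g = zpow t c * v, `|c|%N <= k & reduced k h v].
Proof.
elim: k g => [|k IHk] g.
  move=> [w [/size0nil -> _ ->]]; rewrite big_nil; exists None, 0%R, 1.
  by split; [rewrite /= expg0 mulg1 | | constructor].
rewrite -{1}add1n => /products_split[y [w [sw wS def_y]] /IHk[h [c [v [def_g ck red]]]]].
have {w sw wS def_y} Sy : sym_closure padded_generators y.
  case: w sw wS def_y => [|b [|]] //= _ wS; rewrite big_seq1 => ->.
  by apply: wS; rewrite mem_head.
have {def_g} -> : g = y * (zpow t c * v) by rewrite -def_g mulVKg.
have [[e e1 ->]|[a aX ->]] := padded_generatorsP Sy.
  exists h, (e + c)%R, v; split; [by rewrite zpowD mulgA | lia | exact: reduced_leq red].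
have [[def_h c0]|keep] := pselect (h = Some (flip a) /\ c = 0%R).
  move: red; rewrite def_h => red.
  inversion red as [|a' c' h' v' _ c'k red' _ def_a def_v]; subst.
  exists h', c', v'; split; [|exact: leqW|exact: reduced_leq red'].
  by rewrite /= expg0 mul1g block_flip !mulgA mulgV mul1g.
exists (Some a), 0%R, (block a * zpow t c * v); split=> //.
  by rewrite /= expg0 mul1g mulgA.
apply: ReducedCons aX (leqW ck) (reduced_leq (leqnSn k) red) _.
by move=> def_h c0; apply: keep.
Qed.

Lemma padding_neq0 a c : a.1 \in X -> 0 < M -> `|c|%N <= M ->
  (padding a + c)%R <> 0%R.
Proof.
move=> aX M0 cM; have : 2 * M <= 2 * M * (index a.1 X).+1 by rewrite leq_pmulr.
by rewrite /padding; case: a.2; lia.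
Qed.

Lemma padding_add_neq0 a b c : a.1 \in X -> b.1 \in X -> 0 < M ->
  `|c|%N <= M -> (b = flip a -> c <> 0%R) ->
  (padding a + c + padding b)%R <> 0%R.
Proof.
case: a b => [x e] [y f] /= xX yX M0 cM; rewrite /flip /padding /=.
have lb z : 2 * M <= 2 * M * (index z X).+1 by rewrite leq_pmulr.
have := lb x; have := lb y.
have [<-|neq_xy] := eqVneq x y.
  by case: e f => [] [] /= ? ? hc eq0; try lia; by apply: hc => //; lia.
have neq_i : index x X != index y X.
  by apply: contraNneq neq_xy => eq_i; rewrite -(nth_index x xX) -(nth_index x yX) eq_i.
have [gap|gap] : 2 * M * (index x X).+1 + 2 * M <= 2 * M * (index y X).+1 \/
    2 * M * (index y X).+1 + 2 * M <= 2 * M * (index x X).+1.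
- by move: neq_i; rewrite neq_ltn => /orP[] lt_i; [left|right];
    rewrite addnC -mulnS leq_pmul2l // muln_gt0.
- by case: e f => [] [] /=; lia.
- by case: e f => [] [] /=; lia.
Qed.

Lemma generates_padded : generates [set` X] -> generates padded_generators.
Proof.
move=> genX; apply: (generates_trans genX) => P P1 PM PV PS x xX.
have Pt n : P (t ^+ n).
  by elim: n => [|n IHn]; rewrite ?expg0 // expgS; apply: PM => //; apply: PS; left.
have Pz : P (zpow t (padding (x, true))).
  by case: (padding _) => n; [|apply: PV]; exact: Pt.
have : P (block (x, true)) by apply: PS; right; exists x.
rewrite /block; set z := zpow t _ in Pz * => Pb.
rewrite -(mulKg z x) -(mulgK z (z * x)).
exact: PM (PV _ Pz) (PM _ _ Pb (PV _ Pz)).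
Qed.

Lemma finite_padded : finite_set padded_generators.
Proof.
rewrite finite_setU; split; first exact: finite_set1.
by apply: finite_image; apply/finite_seqP; exists X.
Qed.

Section Length.
Variables (l : G -> nat) (D R B N : nat).
Hypothesis hypl : hyperbolic_length l D.
Hypothesis N_large : R + 2 * B + D.*2.+1 <= N.
Hypothesis M_gt0 : 0 < M.
Hypothesis core_short : forall a, a.1 \in X -> l (core a) <= B.
Hypothesis power_long : forall m, m <> 0%R -> N <= l (zpow t m).
Hypothesis bounded_overlap : forall a m (n : int), a.1 \in X ->
  l (zpow t m) + l (zpow t n) <= l (zpow t m * core a * zpow t n) + R.

(** The power m of t that follows the first letter merges the paddings of two
    neighbouring blocks and the power of t between them; it does not vanish, and
    [len_prefix_grows] applies with factors of the form core a * t^m. *)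
Lemma reduced_suffix_grows h v : reduced M h v -> forall a, h = Some a ->
  exists m r, let u := core a * zpow t m * r in
    [/\ a.1 \in X, m <> 0%R, v = zpow t (padding a) * u,
      l r + D.+1 <= l u & N <= l u + B].
Proof.
have strip a x : a.1 \in X -> l x <= l (core a * x) + B.
  move=> aX; rewrite -{1}(mulKg (core a) x).
  apply: leq_trans (lenM hypl _ _) _; rewrite (lenV hypl) addnC leq_add2l.
  exact: core_short.
elim=> [|a c h' v' aX cM red IH hc] // _ [<-].
case: red IH hc => [|b c1 h1 v1 bX c1M _ hc1] IH hc.
  have m0 := padding_neq0 aX M_gt0 cM; set m := (padding a + c)%R in m0.
  have := strip a (zpow t m) aX; have := power_long m0.
  exists m, 1 => /=; rewrite !mulg1 (len1 hypl).
  split=> //; [by rewrite /m /block zpowD !mulgA | lia | lia].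
have [m [r [_ m0 def_v le_r u_long]]] := IH b erefl.
set u := core b * zpow t m * r in def_v le_r u_long.
have n0 : (padding a + c + padding b)%R <> 0%R.
  by apply: padding_add_neq0 => // eq_b; apply: hc; rewrite eq_b.
set n := (padding a + c + padding b)%R in n0.
have grow : l u + D.+1 <= l (core a * zpow t n * u).
  have := bounded_overlap n m bX; have := strip a (zpow t n * core b * zpow t m) aX.
  have -> : core a * (zpow t n * core b * zpow t m) =
      core a * zpow t n * (core b * zpow t m) by rewrite !mulgA.
  have := lenM hypl (core a) (zpow t n); have := lenM hypl (core b) (zpow t m).
  have := power_long n0; have := power_long m0.
  have := core_short aX; have := core_short bX.
  by move=> *; apply: (len_prefix_grows hypl) le_r; lia.
exists n, u; split=> //; last by lia.
by rewrite /n def_v !zpowD /block !mulgA.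
Qed.

Lemma reduced_long h c v g : reduced M h v -> `|c|%N <= M ->
  l g + B < N -> zpow t c * v = g -> g = 1.
Proof.
move=> red cM g_short def_g.
have [h0|[a ha]] : h = None \/ exists a, h = Some a by case: h {red}; [right; exists a|left].
  have v1 : v = 1 by case: red h0.
  move: def_g; rewrite v1 mulg1 => def_g.
  have [c0|c0] := pselect (c = 0%R); first by rewrite -def_g c0 /= expg0.
  by have := power_long c0; rewrite def_g; lia.
have [m [r [aX m0 def_v le_r u_long]]] := reduced_suffix_grows red ha.
set u := core a * zpow t m * r in def_v le_r u_long.
have n0 : (c + padding a)%R <> 0%R by rewrite GRing.addrC; exact: padding_neq0.
set n := (c + padding a)%R in n0.
have def_gu : g = zpow t n * u by rewrite -def_g def_v mulgA -zpowD.
have : l u + D.+1 <= l (zpow t n * u).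
  have := bounded_overlap n m aX.
  have -> : zpow t n * core a * zpow t m = zpow t n * (core a * zpow t m).
    by rewrite mulgA.
  have := lenM hypl (core a) (zpow t m).
  have := power_long n0; have := power_long m0; have := core_short aX.
  by move=> *; apply: (len_prefix_grows hypl) le_r; lia.
rewrite -def_gu; lia.
Qed.

Lemma padded_word_length_ge g : generates [set` X] -> g <> 1 -> l g + B < N ->
  M < word_length padded_generators g.
Proof.
move=> genX g_neq1 g_short; rewrite ltnNge; apply/negP => le_gM; apply: g_neq1.
have [h [c [v [def_g cM red]]]] :=
  products_reduced (word_lengthP (generates_padded genX) g).
apply: (reduced_long (reduced_leq le_gM red) (leq_trans cM le_gM) g_short).
exact/esym.
Qed.

End Length.
End PaddedGenerators.

(** Some generator y0 is outside the commensurator, and multiplying the other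
    generators by y0 where necessary moves them out of it. *)
Lemma noncommensurating_generators (G : groupType) (S : set G) (s g : G) :
    finite_set S -> generates S -> ~ commensurates s g ->
  exists2 X : seq G, generates [set` X] & forall x, x \in X -> ~ commensurates s x.
Proof.
move=> /finite_seqP[Y ->] genY ncomm_g.
have [y0 y0Y ncomm_y0] : exists2 y, y \in Y & ~ commensurates s y.
  apply: contrapT => none; apply: ncomm_g; apply: (generates_subgroup genY).
  - exact: commensurates1.
  - exact: commensuratesM.
  - exact: commensuratesV.
  - by move=> y yY; apply: contrapT => ny; apply: none; exists y.
pose f y := if `[< commensurates s y >] then y * y0 else y.
exists (y0 :: [seq f y | y <- Y]).
  apply: (generates_trans genY) => P P1 PM PV PX y yY.
  have : P (f y) by apply: PX; rewrite /= inE map_f ?orbT.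
  rewrite /f; case: ifP => // _ Pyy0; rewrite -(mulgK y0 y); apply: PM => //.
  by apply/PV/PX; rewrite /= mem_head.
move=> x; rewrite inE => /predU1P[->//|/mapP[y yY ->]]; rewrite /f.
case: asboolP => // comm_y comm_yy0; apply: ncomm_y0; rewrite -(mulKg y y0).
by apply: commensuratesM => //; exact: commensuratesV.
Qed.

Lemma uniform_bound (T : eqType) (X : seq T) (P : T -> nat -> Prop) :
    (forall x m n, m <= n -> P x m -> P x n) ->
    (forall x, x \in X -> exists n, P x n) ->
  exists n, forall x, x \in X -> P x n.
Proof.
move=> monoP; elim: X => [|x X IHX] exP; first by exists 0.
have [|n Pn] := IHX; first by move=> y yX; apply: exP; rewrite inE yX orbT.
have [m Pm] := exP x (mem_head _ _); exists (m + n) => y; rewrite inE => /predU1P[->|yX].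
  exact: monoP (leq_addr _ _) Pm.
exact: monoP (leq_addl _ _) (Pn y yX).
Qed.

Theorem unbounded_word_length (G : groupType) (g : G) (M : nat) :
    hyperbolic G -> ~ elementary G -> g <> 1 ->
  exists S : set G, [/\ finite_set S, generates S & M < word_length S g].
Proof.
move=> /hyperbolic_has_length[S [D [finS genS hypl]]] hne g_neq1.
have [s lox] : exists s, loxodromic (word_length S) D s.
  by apply: (exists_loxodromic hypl) => finG; apply: hne; left.
have [|h ncomm_h] := commensurator_proper hypl lox; first by move=> vc; apply: hne; right.
have [X genX ncommX] := noncommensurating_generators finS genS ncomm_h.
set l := word_length S in hypl lox.
pose bounded (x : G) R := forall m n : int,
  l (zpow s m) + l (zpow s n) <= l (zpow s m * x * zpow s n) + R.
have [R overlapR] : exists R, forall x, x \in X -> bounded x R /\ bounded x^-1 R.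
  apply: uniform_bound => [x m n le_mn [bx bx']|x /ncommX ncomm_x].
    split=> i j; [have := bx i j | have := bx' i j]; lia.
  have [R1 b1] := not_commensurates_bounded_overlap hypl lox ncomm_x.
  have [|R2 b2] := not_commensurates_bounded_overlap hypl lox (g := x^-1).
    by move=> /commensuratesV; rewrite invgK.
  exists (R1 + R2); split=> i j; [have := b1 i j | have := b2 i j]; lia.
have [B shortB] : exists B, forall x, x \in X -> l x <= B.
  by apply: uniform_bound => [x m n le_mn /leq_trans->//|x _]; exists (l x).
pose N := R + 2 * B + D.*2.+1 + l g.
exists (padded_generators (s ^+ N) X M.+1); split.
- exact: finite_padded.
- exact: generates_padded.
have zpowN_s m : zpow (s ^+ N) m = zpow s (Posz N * m)%R by rewrite zpowM.
apply: ltnW; apply: (padded_word_length_ge hypl (N := N) (R := R) (B := B)) => //.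
- by rewrite /N; lia.
- by move=> [x []] /= xX; rewrite /core /= ?(lenV hypl); exact: shortB.
- move=> m m0; rewrite zpowN_s (len_zpow hypl); apply: leq_trans (lox_len_ge hypl lox _).
  by nia.
- by move=> [x []] m n /= xX; rewrite !zpowN_s; have [] := overlapR x xX.
- by rewrite /N; lia.
Qed.

Theorem corollary3p5 (G : groupType) (hG : hyperbolic G)
  (hne : ~ elementary G) : G_bound G = [set 1%g]%classic.
Proof.
apply/seteqP; split=> g /=.
  move=> [M _ boundM]; apply: contrapT => g_neq1.
  have [S [finS genS long]] := unbounded_word_length M hG hne g_neq1.
  by have := boundM S finS genS; rewrite ltnNge (ltnW long).
by move=> ->; exists 1%N => // S _ _; rewrite word_length1.
Qed.
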